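(* Let $S:\mathbb{R}^n\rightrightarrows\mathbb{R}^m$ be locally closed at $(\bar x,\bar y)\in\mathrm{gph}(S)$ and let $H:\mathbb{R}^n\rightrightarrows\mathbb{R}^m$ be a prefan. Then $S$ is pseudo strictly $H$-differentiable at $(\bar x,\bar y)$ if and only if any of the following equivalent conditions hold: (a) For all $p\in\mathbb{R}^n\setminus\{0\}$ and all $(v,-u)\in N_{\mathrm{gph}(S)}(\bar x,\bar y)$ (with $v\in\mathbb{R}^n$, $u\in\mathbb{R}^m$), there exists $y\in H(p)$ such that $\langle u,y\rangle\le\langle v,p\rangle$. (b) For all $p\in\mathbb{R}^n\setminus\{0\}$ and $u\in\mathbb{R}^m$, $\displaystyle\min_{y\in H(p)}\langle u,y\rangle\le\min_{v\in D^{*}S(\bar x\mid\bar y)(u)}\langle v,p\rangle$. (c) For all $p\in\mathbb{R}^n\setminus\{0\}$ and $u\in\mathbb{R}^m$, $\displaystyle\min_{y\in H(p)}\langle u,y\rangle\le\min_{v\in\mathrm{cl}\,\mathrm{co}\,D^{*}S(\bar x\mid\bar y)(u)}\langle v,p\rangle$.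
   Context: A set-valued map $S:\mathbb{R}^n\rightrightarrows\mathbb{R}^m$ assigns to each $x$ a subset $S(x)\subset\mathbb{R}^m$ (possibly empty); its graph is $\mathrm{gph}(S)=\{(x,y)\mid y\in S(x)\}$. $S$ is locally closed at $(\bar x,\bar y)\in\mathrm{gph}(S)$ if $\mathrm{gph}(S)\cap\mathbb{B}_\epsilon((\bar x,\bar y))$ is closed for some $\epsilon>0$, where $\mathbb{B}_\epsilon(z)$ is the closed ball of radius $\epsilon$ centered at $z$; $\mathbb{B}$ is the closed unit ball. Norms are Euclidean. $H:\mathbb{R}^n\rightrightarrows\mathbb{R}^m$ is positively homogeneous if $0\in H(0)$ and $H(kw)=kH(w)$ for all $k>0$, $w\in\mathbb{R}^n$. For a real $\delta>0$, $(H+\delta)(w):=H(w)+\delta\|w\|\mathbb{B}$. $H$ is a prefan if it is positively homogeneous, $H(p)$ is nonempty, convex and compact for all $p$, and $\|H\|^{+}:=\sup_{\|w\|\le1}\sup_{z\in H(w)}\|z\|$ is finite. $S$ is pseudo strictly $H$-differentiable at $(\bar x,\bar y)\in\mathrm{gph}(S)$ if for any $\delta>0$ there are neighborhoods $U_\delta$ of $\bar x$ and $V_\delta$ of $\bar y$ such that $S(x)\cap V_\delta\subset S(x')+(H+\delta)(x-x')$ for all $x,x'\in U_\delta$. For $C\subset\mathbb{R}^N$ and $\bar z\in C$, the regular normal cone is $\hat N_C(\bar z)=\{w\mid\langle w,z-\bar z\rangle\le o(\|z-\bar z\|)\text{ for all }z\in C\}$, and the limiting normal cone is $N_C(\bar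 z)=\{w\mid\exists z_i\to\bar z,\ z_i\in C,\ w_i\in\hat N_C(z_i),\ w_i\to w\}$. The limiting coderivative $D^{*}S(\bar x\mid\bar y):\mathbb{R}^m\rightrightarrows\mathbb{R}^n$ is defined by $v\in D^{*}S(\bar x\mid\bar y)(u)\iff(v,-u)\in N_{\mathrm{gph}(S)}(\bar x,\bar y)$. $\mathrm{cl}\,\mathrm{co}\,D^{*}S(\bar x\mid\bar y)(u)$ is the closed convex hull of the set $D^{*}S(\bar x\mid\bar y)(u)$. The minima on the right-hand sides in (b) and (c) are understood as infima in $[-\infty,+\infty]$, equal to $+\infty$ over the empty set. *)

(* Defs.v *)
From HB Require Import structures.
From mathcomp Require Export all_boot all_order all_algebra.
From mathcomp Require Export all_classical all_reals all_analysis.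
Export Order.TTheory GRing.Theory Num.Theory.
Export numFieldNormedType.Exports.

Set Implicit Arguments.
Unset Strict Implicit.
Unset Printing Implicit Defensive.

Local Open Scope classical_set_scope.
Local Open Scope ring_scope.

(* The canonical norm of 'rV[R]_n is the sup norm, hence the explicit Euclidean
   structure. The topology of 'rV[R]_n is the usual one. *)
Definition dot (R : realType) (n : nat) (u v : 'rV[R]_n) : R :=
  \sum_(i < n) u ord0 i * v ord0 i.

Definition enorm (R : realType) (n : nat) (u : 'rV[R]_n) : R :=
  Num.sqrt (dot u u).

Definition eball (R : realType) (n : nat) (z : 'rV[R]_n) (r : R) :
    set 'rV[R]_n :=
  [set z' | enorm (z' - z) <= r].

Definition setmap (R : realType) (n m : nat) := 'rV[R]_n -> set 'rV[R]_m.

(* R^n x R^m is 'rV[R]_(n + m), the pair (x, y) being row_mx x y. *)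
Definition gph (R : realType) (n m : nat) (S : setmap R n m) :
    set 'rV[R]_(n + m) :=
  [set z | exists x y, S x y /\ z = row_mx x y].

Definition locally_closed_at (R : realType) (n m : nat) (S : setmap R n m)
    (xbar : 'rV[R]_n) (ybar : 'rV[R]_m) : Prop :=
  exists2 e : R, 0 < e & closed (gph S `&` eball (row_mx xbar ybar) e).

Definition positively_homogeneous (R : realType) (n m : nat)
    (H : setmap R n m) : Prop :=
  H 0 0 /\
  forall (k : R) (w : 'rV[R]_n), 0 < k -> H (k *: w) = [set k *: z | z in H w].

Definition outer_norm (R : realType) (n m : nat) (H : setmap R n m) : \bar R :=
  ereal_sup [set ereal_sup [set (enorm z)%:E | z in H w]
            | w in [set w : 'rV[R]_n | enorm w <= 1]].

Definition prefan (R : realType) (n m : nat) (H : setmap R n m) : Prop :=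
  [/\ positively_homogeneous H,
      forall p, [/\ H p !=set0, convex_set (H p) & compact (H p)] &
      outer_norm H \is a fin_num].

(* H(w) + d ||w|| B *)
Definition fatten (R : realType) (n m : nat) (H : setmap R n m) (d : R) :
    setmap R n m :=
  fun w => [set z + (d * enorm w) *: b | z in H w & b in eball 0 1].

Definition pseudo_strictly_differentiable (R : realType) (n m : nat)
    (S H : setmap R n m) (xbar : 'rV[R]_n) (ybar : 'rV[R]_m) : Prop :=
  forall d : R, 0 < d ->
    exists (U : set 'rV[R]_n) (V : set 'rV[R]_m),
      [/\ nbhs xbar U, nbhs ybar V &
          forall x x', U x -> U x' ->
            S x `&` V `<=`
              [set y + z | y in S x' & z in fatten H d (x - x')]].

(* <w, z - zbar> <= o(||z - zbar||) for z in C, z -> zbar *)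
Definition regular_normal_cone (R : realType) (N : nat) (C : set 'rV[R]_N)
    (zbar : 'rV[R]_N) : set 'rV[R]_N :=
  [set w | forall e : R, 0 < e ->
     \forall z \near within C (nbhs zbar),
       dot w (z - zbar) <= e * enorm (z - zbar)].

Definition limiting_normal_cone (R : realType) (N : nat) (C : set 'rV[R]_N)
    (zbar : 'rV[R]_N) : set 'rV[R]_N :=
  [set w | exists z_ w_ : nat -> 'rV[R]_N,
     [/\ z_ @ \oo --> zbar,
         forall i, C (z_ i),
         forall i, regular_normal_cone C (z_ i) (w_ i) &
         w_ @ \oo --> w]].

Definition limiting_coderivative (R : realType) (n m : nat) (S : setmap R n m)
    (xbar : 'rV[R]_n) (ybar : 'rV[R]_m) : setmap R m n :=
  fun u => [set v | limiting_normal_cone (gph S) (row_mx xbar ybar)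
                      (row_mx v (- u))].

Definition closed_convex_hull (R : realType) (n : nat) (A : set 'rV[R]_n) :
    set 'rV[R]_n :=
  closure (smallest (fun B : set 'rV[R]_n => convex_set B) A).

(* Main.v *)
(** Both implications go through an approximate form of (a) at the regular
    normals [(v, -u)] of [gph S] near the reference point: for each direction
    [p] some [h] in [H p] satisfies [<u, h> <= <v, p> + d |p| |u|].
    Differentiability gives it by testing the normal on the points that the
    inclusion produces over [x - t p]. It gives (a) in the limit, and follows
    from (a) by compactness of the unit normals: (a) is applied to a limit
    normal at the very directions where the approximate form fails, so that
    boundedness of [H] suffices and no continuity in [p] is needed. Conversely,
    for [p = x - x'] it says that [gph S] is weakly invariant under the constant
    convex set of velocities [{-p} x -(H + d)(p)]; an Euler scheme that aims
    along proximal normals then leads from [(x, y)] in unit time to a point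
    [(x', y')] of [gph S] with [y - y'] in [(H + d)(p)]. *)

Require Import Defs.
From mathcomp Require Import ring lra.

Local Open Scope classical_set_scope.
Local Open Scope ring_scope.

(** * Euclidean structure of row vectors *)

Section euclidean.
Set Implicit Arguments.
Unset Strict Implicit.
Context {R : realType}.
Implicit Types n : nat.

Lemma dotC n (u v : 'rV[R]_n) : dot u v = dot v u.
Proof. by apply: eq_bigr => i _; rewrite mulrC. Qed.

Lemma dotDl n (u v w : 'rV[R]_n) : dot (u + v) w = dot u w + dot v w.
Proof. by rewrite -big_split; apply: eq_bigr => i _; rewrite mxE mulrDl. Qed.

Lemma dotZl n a (u v : 'rV[R]_n) : dot (a *: u) v = a * dot u v.
Proof. by rewrite mulr_sumr; apply: eq_bigr => i _; rewrite mxE mulrA. Qed.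

Lemma dotNl n (u v : 'rV[R]_n) : dot (- u) v = - dot u v.
Proof. by rewrite -scaleN1r dotZl mulN1r. Qed.

Lemma dotDr n (u v w : 'rV[R]_n) : dot u (v + w) = dot u v + dot u w.
Proof. by rewrite dotC dotDl !(dotC _ u). Qed.

Lemma dotZr n a (u v : 'rV[R]_n) : dot u (a *: v) = a * dot u v.
Proof. by rewrite dotC dotZl dotC. Qed.

Lemma dotNr n (u v : 'rV[R]_n) : dot u (- v) = - dot u v.
Proof. by rewrite dotC dotNl dotC. Qed.

Lemma dot0l n (u : 'rV[R]_n) : dot 0 u = 0.
Proof. by rewrite -(scale0r u) dotZl mul0r. Qed.

Lemma dot0r n (u : 'rV[R]_n) : dot u 0 = 0.
Proof. by rewrite dotC dot0l. Qed.

Lemma dot_ge0 n (u : 'rV[R]_n) : 0 <= dot u u.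
Proof. by apply: sumr_ge0 => i _; rewrite -expr2 sqr_ge0. Qed.

Lemma dot_row_mx n m (a c : 'rV[R]_n) (b d : 'rV[R]_m) :
  dot (row_mx a b) (row_mx c d) = dot a c + dot b d.
Proof.
rewrite /dot big_split_ord /=; congr (_ + _); apply: eq_bigr => i _.
  by rewrite !row_mxEl.
by rewrite !row_mxEr.
Qed.

Lemma enorm_ge0 n (u : 'rV[R]_n) : 0 <= enorm u.
Proof. exact: sqrtr_ge0. Qed.

Lemma sqr_enorm n (u : 'rV[R]_n) : enorm u ^+ 2 = dot u u.
Proof. by rewrite sqr_sqrtr// dot_ge0. Qed.

Lemma enorm_le n (u : 'rV[R]_n) a : 0 <= a -> dot u u <= a ^+ 2 -> enorm u <= a.
Proof.
move=> a0 ua.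
by rewrite -(@ler_pXn2r _ 2)// ?nnegrE ?enorm_ge0// sqr_enorm.
Qed.

Lemma enorm_lt n (u : 'rV[R]_n) a : 0 < a -> dot u u < a ^+ 2 -> enorm u < a.
Proof.
move=> a0 ua.
by rewrite -(@ltr_pXn2r _ 2)// ?nnegrE ?enorm_ge0 ?ltW// sqr_enorm.
Qed.

Lemma enorm0 n : enorm (0 : 'rV[R]_n) = 0.
Proof. by rewrite /enorm dot0l sqrtr0. Qed.

Lemma enorm_eq0 n (u : 'rV[R]_n) : (enorm u == 0) = (u == 0).
Proof.
apply/eqP/eqP => [u0|->]; last exact: enorm0.
have /eqP := sqr_enorm u; rewrite u0 expr0n/= eq_sym psumr_eq0; last first.
  by move=> i _; rewrite -expr2 sqr_ge0.
move=> /allP ui0; apply/rowP => i; rewrite mxE; apply/eqP.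
by have := ui0 i (mem_index_enum _); rewrite /= mulf_eq0 orbb.
Qed.

Lemma enorm_gt0 n (u : 'rV[R]_n) : (0 < enorm u) = (u != 0).
Proof. by rewrite lt_neqAle enorm_ge0 andbT eq_sym enorm_eq0. Qed.

Lemma enormZ n a (u : 'rV[R]_n) : enorm (a *: u) = `|a| * enorm u.
Proof.
by rewrite /enorm dotZl dotZr mulrA -expr2 sqrtrM ?sqr_ge0// sqrtr_sqr.
Qed.

Lemma enormN n (u : 'rV[R]_n) : enorm (- u) = enorm u.
Proof. by rewrite /enorm dotNl dotNr opprK. Qed.

Lemma enormB n (u v : 'rV[R]_n) : enorm (u - v) = enorm (v - u).
Proof. by rewrite -enormN opprB. Qed.

(** For nonzero vectors, the squared length of [enorm v *: u - enorm u *: v] is twice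
    [enorm u * enorm v] times the difference of the two sides. *)
Lemma dot_le n (u v : 'rV[R]_n) : dot u v <= enorm u * enorm v.
Proof.
have [->|v0] := eqVneq v 0; first by rewrite dot0r enorm0 mulr0.
have [->|u0] := eqVneq u 0; first by rewrite dot0l enorm0 mul0r.
have := dot_ge0 (enorm v *: u - enorm u *: v).
rewrite !(dotDl, dotDr, dotZl, dotZr, dotNl, dotNr) (dotC v u) -!sqr_enorm => h.
have a0 : 0 < enorm u by rewrite enorm_gt0.
have b0 : 0 < enorm v by rewrite enorm_gt0.
rewrite -subr_ge0 -(pmulr_rge0 _ (mulr_gt0 a0 b0)); lra.
Qed.

Lemma abs_dot_le n (u v : 'rV[R]_n) : `|dot u v| <= enorm u * enorm v.
Proof.
rewrite ler_norml dot_le andbT lerNl -dotNl; apply: le_trans (dot_le _ _) _.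
by rewrite enormN.
Qed.

Lemma dot_sqrD n (u v : 'rV[R]_n) :
  dot (u + v) (u + v) = dot u u + 2 * dot u v + dot v v.
Proof. by rewrite !(dotDl, dotDr) (dotC v u); ring. Qed.

Lemma enormD n (u v : 'rV[R]_n) : enorm (u + v) <= enorm u + enorm v.
Proof.
apply: enorm_le; first by rewrite addr_ge0// enorm_ge0.
by rewrite dot_sqrD -!sqr_enorm; have := dot_le u v; lra.
Qed.

Lemma enorm_dist n (v u w : 'rV[R]_n) :
  enorm (u - w) <= enorm (u - v) + enorm (v - w).
Proof. by have := enormD (u - v) (v - w); rewrite addrA subrK. Qed.

Lemma enorm_lub_dist n (u v : 'rV[R]_n) : `|enorm u - enorm v| <= enorm (u - v).
Proof.
have := enorm_dist v u 0; have := enorm_dist u v 0.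
rewrite !subr0 (enormB v u) => h1 h2; rewrite ler_norml; lra.
Qed.

Lemma enorm_row_mx n m (a : 'rV[R]_n) (b : 'rV[R]_m) :
  enorm (row_mx a b) <= enorm a + enorm b.
Proof.
have := enormD (row_mx a 0) (row_mx 0 b); rewrite add_row_mx addr0 add0r.
by rewrite /enorm !dot_row_mx !dot0l addr0 add0r.
Qed.

Lemma enorm_row_mxl n m (a : 'rV[R]_n) (b : 'rV[R]_m) :
  enorm a <= enorm (row_mx a b).
Proof. by rewrite ler_wsqrtr// dot_row_mx lerDl dot_ge0. Qed.

Lemma enorm_row_mxr n m (a : 'rV[R]_n) (b : 'rV[R]_m) :
  enorm b <= enorm (row_mx a b).
Proof. by rewrite ler_wsqrtr// dot_row_mx lerDr dot_ge0. Qed.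

(** * Topology and compactness through the Euclidean norm *)

Lemma norm_le_enorm n (u : 'rV[R]_n) : `|u| <= enorm u.
Proof.
rewrite [leLHS]/Num.Def.normr /= mx_normrE; apply/bigmax_leP.
split=> [|[i j] _ /=].
  exact: enorm_ge0.
rewrite (ord1 i) -(sqrtr_sqr (u ord0 j)) ler_wsqrtr// /dot (bigD1 j)//= -expr2.
by rewrite lerDl; apply: sumr_ge0 => k _; rewrite -expr2 sqr_ge0.
Qed.

(** The crude factor [n.+1], in place of the square root of [n], stays positive for [n = 0], so that
    radii can be divided by it. *)
Lemma enorm_le_norm n (u : 'rV[R]_n) : enorm u <= n.+1%:R * `|u|.
Proof.
apply: enorm_le; first by rewrite mulr_ge0.
have ule i : u ord0 i * u ord0 i <= `|u| ^+ 2.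
  rewrite -expr2 -real_normK ?num_real// ler_pXn2r ?nnegrE//.
  rewrite [leRHS]/Num.Def.normr /= mx_normrE.
  exact: (@le_bigmax _ _ _ _ _ (ord0, i)).
apply: (@le_trans _ _ (\sum_(i < n) `|u| ^+ 2)); first exact: ler_sum.
rewrite sumr_const card_ord -[leLHS]mulr_natl exprMn.
apply: ler_wpM2r; first exact: sqr_ge0.
by rewrite -natrX ler_nat expnS (leq_trans (leqnSn n))// leq_pmulr// expn_gt0.
Qed.

Lemma nbhs_enormP n (x : 'rV[R]_n) (U : set 'rV[R]_n) :
  nbhs x U <-> exists2 e : R, 0 < e & forall y, enorm (y - x) < e -> U y.
Proof.
split.
  move=> /nbhs_normP[e /= e0 eU]; exists e => // y xy; apply: eU => /=.
  by rewrite distrC (le_lt_trans (norm_le_enorm _)).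
move=> [e e0 eU]; apply: (proj2 (nbhs_normP x U)); exists (e / n.+1%:R) => /=.
  by rewrite divr_gt0.
move=> y /= xy; apply: eU; apply: le_lt_trans (enorm_le_norm _) _.
by rewrite mulrC -ltr_pdivlMr// distrC.
Qed.

Lemma cvg_enormP n (z_ : nat -> 'rV[R]_n) (z : 'rV[R]_n) :
  z_ @ \oo --> z <->
  forall e : R, 0 < e -> \forall i \near \oo, enorm (z_ i - z) < e.
Proof.
split=> [zz e e0|zz U /nbhs_enormP[e e0 eU]].
  by apply: (zz [set y | enorm (y - z) < e]); apply/nbhs_enormP; exists e.
by have := zz e e0; apply: filterS => i /eU.
Qed.

Lemma closure_enormP n (A : set 'rV[R]_n) (x : 'rV[R]_n) :
  closure A x <-> forall e : R, 0 < e -> exists2 a, A a & enorm (a - x) < e.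
Proof.
split=> [Ax e e0|Ax U /nbhs_enormP[e e0 eU]].
  have [|a [Aa xa]] := Ax [set y | enorm (y - x) < e].
    by apply/nbhs_enormP; exists e.
  by exists a.
by have [a Aa /eU] := Ax e e0; exists a.
Qed.

Lemma lipschitz_enorm_continuous n (f : 'rV[R]_n -> R) (k : R) :
  (forall x y, `|f x - f y| <= k * enorm (x - y)) -> continuous f.
Proof.
move=> fk x U /nbhs_normP[e /= e0 eU].
apply: (proj2 (nbhs_enormP x (f @^-1` U))).
have k1 : 0 < `|k| + 1 by have := normr_ge0 k; lra.
exists (e / (`|k| + 1)) => [|y]; first by rewrite divr_gt0.
rewrite ltr_pdivlMr// enormB => xy; apply: eU; apply: le_lt_trans (fk _ _) _.
apply: le_lt_trans xy; rewrite mulrC ler_wpM2l ?enorm_ge0//.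
by have := ler_norm k; lra.
Qed.

Lemma continuous_dot n (u : 'rV[R]_n) : continuous (dot u).
Proof.
apply: (@lipschitz_enorm_continuous _ _ (enorm u)) => x y.
by rewrite -dotNr -dotDr abs_dot_le.
Qed.

Lemma continuous_enorm_sub n (u : 'rV[R]_n) :
  continuous (fun x : 'rV[R]_n => enorm (x - u)).
Proof.
apply: (@lipschitz_enorm_continuous _ _ 1) => x y; rewrite mul1r.
by rewrite (le_trans (enorm_lub_dist _ _))// opprB addrA subrK.
Qed.

Lemma compact_min n (A : set 'rV[R]_n) (f : 'rV[R]_n -> R) :
  A !=set0 -> compact A -> continuous f ->
  exists2 a, A a & forall b, A b -> f a <= f b.
Proof.
move=> A0 cA cf; have [|a /set_mem Aa fa] := EVT_min_rV (f := f) A0 cA.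
  exact: continuous_subspaceT.
by exists a => // b Ab; apply/fa/mem_set.
Qed.

(** A minimizer of [f] does at least as well as every approximate solution. This turns estimates
    with an error [e] into exact ones over [H p]. *)
Lemma compact_le n (A : set 'rV[R]_n) (f : 'rV[R]_n -> R) (c : R) :
  compact A -> continuous f ->
  (forall e, 0 < e -> exists2 a, A a & f a <= c + e) ->
  exists2 a, A a & f a <= c.
Proof.
move=> cA cf fc; have [a1 Aa1 _] := fc 1 ltr01.
have [|a Aa fa] := compact_min (A := A) _ cA cf; first by exists a1.
exists a => //; apply/ler_addgt0Pr => e /fc[b Ab fb].
exact: le_trans (fa b Ab) fb.
Qed.

Lemma bounded_enorm_compact n (A : set 'rV[R]_n) (x : 'rV[R]_n) (M : R) :
  closed A -> (forall a, A a -> enorm (a - x) <= M) -> compact A.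
Proof.
move=> clA AM; apply: bounded_closed_compact => //.
exists (M + enorm x); split; first exact: num_real.
move=> N MN a Aa; apply: le_trans (norm_le_enorm _) _.
apply: le_trans (ltW MN); rewrite -[a](subrK x).
by apply: le_trans (enormD _ _) _; rewrite lerD2r AM.
Qed.

Lemma bounded_seq_cluster n (w : nat -> 'rV[R]_n) (M : R) :
  (forall i, enorm (w i) <= M) ->
  exists l, forall e, 0 < e -> forall N,
    exists2 i, (N <= i)%N & enorm (w i - l) < e.
Proof.
move=> wM.
have cB : compact [set y : 'rV[R]_n | enorm y <= M].
  apply: (@bounded_enorm_compact _ _ 0 M); last by move=> a; rewrite subr0.
  move=> x /closure_enormP xM; apply/ler_addgt0Pr => e /xM[a /= aM ax].
  have := enorm_dist a x 0; rewrite !subr0 enormB; lra.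
have [|l [_ cl]] := cB (w @ \oo) _; first by exists 0%N => // i _; exact: wM.
exists l => e e0 N.
have [||y [[i /= Ni <-] wl]] :=
    cl [set w i | i in [set i | (N <= i)%N]] [set y | enorm (y - l) < e].
- by exists N => // i /= Ni; exists i.
- by apply/nbhs_enormP; exists e.
by exists i.
Qed.

End euclidean.

(** * Weak invariance and normal cones *)

Section variational.
Context {R : realType}.
Set Implicit Arguments.
Unset Strict Implicit.
Implicit Types n m : nat.

Lemma row_mx_split n m (w : 'rV[R]_(n + m)) : exists v u, w = row_mx v (- u).
Proof. by exists (lsubmx w), (- rsubmx w); rewrite opprK hsubmxK. Qed.

Lemma convex_setE n (A : set 'rV[R]_n) :
  convex_set A <->
  forall x y (t : R), A x -> A y -> 0 <= t -> t <= 1 ->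
    A (t *: x + (1 - t) *: y).
Proof.
split=> [cA x y t Ax Ay t0 t1|cA x y l /set_mem Ax /set_mem Ay].
  by have /set_mem := cA x y (Itv01 t0 t1) (mem_set Ax) (mem_set Ay).
by apply/mem_set/cA.
Qed.

(* Euler scheme with proximal aiming: moving from [z] along a direction making
   a nonacute angle with [z - s], [s] a nearest point of [C] to [z], increases
   the squared distance to [C] only by the square of the step length. *)
Lemma euler_proximal_aiming n (C F : set 'rV[R]_n) (z0 : 'rV[R]_n) (L : R)
    (N k : nat) :
  compact C -> C z0 -> F !=set0 -> convex_set F ->
  (forall f, F f -> enorm f <= L) ->
  (forall z s : 'rV[R]_n, enorm (z - z0) <= L -> C s ->
     (forall c, C c -> enorm (z - s) <= enorm (z - c)) ->
     exists2 f, F f & dot (z - s) f <= 0) ->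
  (k <= N.+1)%N ->
  exists f s, [/\ F f, C s &
    enorm (z0 + (k%:R / N.+1%:R) *: f - s) ^+ 2 <= k%:R * (L / N.+1%:R) ^+ 2].
Proof.
move=> cC Cz0 [f0 Ff0] /convex_setE cvxF FL aim.
have N0 : 0 < N.+1%:R :> R by [].
have L0 : 0 <= L by apply: le_trans (FL _ Ff0); exact: enorm_ge0.
elim: k => [_|k IH kN].
  exists f0, z0; split=> //.
  by rewrite mul0r scale0r addr0 subrr enorm0 expr0n mul0r.
have [g [s' [Fg Cs' gs']]] := IH (ltnW kN).
set z := z0 + _ in gs'.
have [|s Cs sz] := compact_min (A := C) _ cC (@continuous_enorm_sub R n z).
  by exists z0.
have {}sz c : C c -> enorm (z - s) <= enorm (z - c).
  by move=> /sz; rewrite enormB (enormB c).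
have [|f Ff zsf] := aim z s _ Cs sz.
  rewrite /z addrAC subrr add0r enormZ ger0_norm ?divr_ge0// -[leRHS]mul1r.
  apply: ler_pM; rewrite ?divr_ge0 ?enorm_ge0 ?FL//.
  by rewrite ler_pdivrMr// mul1r ler_nat ltnW.
have k1 : 0 < k.+1%:R :> R by [].
have k0 : 0 <= k%:R :> R by [].
have kS : k.+1%:R = k%:R + 1 :> R by rewrite natr1.
(* The vector [g] is the mean of the first [k] velocities. This weight updates the mean with the new
   velocity [f], and convexity keeps it in [F]. *)
pose t : R := k%:R / k.+1%:R.
exists (t *: g + (1 - t) *: f), s; split=> //.
  by apply: cvxF => //; rewrite /t ?divr_ge0// ler_pdivrMr// mul1r kS lerDl.
have -> : z0 + (k.+1%:R / N.+1%:R) *: (t *: g + (1 - t) *: f) - s =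
    (z - s) + N.+1%:R^-1 *: f.
  rewrite scalerDr !scalerA /z.
  have -> : k.+1%:R / N.+1%:R * t = k%:R / N.+1%:R.
    by rewrite /t; field; rewrite !nat1r !pnatr_eq0.
  have -> : k.+1%:R / N.+1%:R * (1 - t) = N.+1%:R^-1.
    by rewrite /t kS; field; rewrite nat1r natr1 !pnatr_eq0.
  by rewrite addrA [LHS]addrAC.
rewrite sqr_enorm dot_sqrD -!sqr_enorm enormZ dotZr gtr0_norm ?invr_gt0//.
have h1 : enorm (z - s) ^+ 2 <= k%:R * (L / N.+1%:R) ^+ 2.
  by apply: le_trans gs'; rewrite ler_pXn2r ?nnegrE ?enorm_ge0// sz.
have h2 : N.+1%:R^-1 * dot (z - s) f <= 0.
  by rewrite pmulr_rle0 ?invr_gt0.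
have h3 : (N.+1%:R^-1 * enorm f) ^+ 2 <= (L / N.+1%:R) ^+ 2.
  rewrite ler_pXn2r ?nnegrE ?divr_ge0 ?mulr_ge0 ?invr_ge0 ?enorm_ge0//.
  by rewrite mulrC ler_wpM2r ?invr_ge0 ?FL.
rewrite kS [leRHS]mulrDl mul1r lerD// -[leRHS]addr0 lerD//.
by rewrite pmulr_rle0.
Qed.

(** After all [N.+1] Euler steps the squared distance to [C] is at most [L ^+ 2 / N.+1]. A cluster
    point of the mean velocities is the required [f], since [F] and [C] are closed. *)
Lemma weak_invariance n (C F : set 'rV[R]_n) (z0 : 'rV[R]_n) (L : R) :
  compact C -> C z0 -> F !=set0 -> closed F -> convex_set F ->
  (forall f, F f -> enorm f <= L) ->
  (forall z s : 'rV[R]_n, enorm (z - z0) <= L -> C s ->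
     (forall c, C c -> enorm (z - s) <= enorm (z - c)) ->
     exists2 f, F f & dot (z - s) f <= 0) ->
  exists2 f, F f & C (z0 + f).
Proof.
move=> cC Cz0 F0 clF cvxF FL aim.
have /choice[f_ /all_and2[Ff_ f_C]] : forall N : nat, exists f, F f /\
    exists2 s, C s & enorm (z0 + f - s) ^+ 2 <= L ^+ 2 / N.+1%:R.
  move=> N; have [f [s [Ff Cs]]] :=
    euler_proximal_aiming cC Cz0 F0 cvxF FL aim (leqnn N.+1).
  rewrite divff ?pnatr_eq0// scale1r => fs.
  exists f; split=> //; exists s => //; apply: le_trans fs _.
  suff -> : N.+1%:R * (L / N.+1%:R) ^+ 2 = L ^+ 2 / N.+1%:R by [].
  by field; rewrite nat1r pnatr_eq0.
have [l fl] := bounded_seq_cluster (fun N => FL _ (Ff_ N)).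
exists l.
  apply: clF; apply/closure_enormP => e /fl/(_ 0%N)[i _ il].
  by exists (f_ i).
apply: (compact_closed (@norm_hausdorff _ _) cC).
apply/closure_enormP => e e0.
have e2 : 0 < e / 2 by lra.
(* The added 1 keeps the divisor positive when [L = 0]. *)
have L1 : 0 < L ^+ 2 + 1 by have := sqr_ge0 L; lra.
have d0 : 0 < (e / 2) ^+ 2 / (L ^+ 2 + 1) by rewrite divr_gt0// exprn_gt0.
have [N _ Nd] := near_infty_natSinv_lt (PosNum d0).
have [i Ni il] := fl _ e2 N; have [s Cs si] := f_C i.
exists s => //; apply: le_lt_trans (enorm_dist (z0 + f_ i) _ _) _.
have -> : z0 + f_ i - (z0 + l) = f_ i - l by rewrite opprD addrACA subrr add0r.
suff : enorm (s - (z0 + f_ i)) < e / 2 by lra.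
rewrite enormB; apply: enorm_lt => //; rewrite -sqr_enorm.
apply: le_lt_trans si _; have := Nd i Ni; rewrite /= ltr_pdivlMr// => h.
by apply: le_lt_trans h; rewrite mulrC ler_wpM2l ?invr_ge0//; lra.
Qed.

(** * Regular and limiting normals *)

Lemma regular_normal_coneP n (C : set 'rV[R]_n) (z w : 'rV[R]_n) :
  regular_normal_cone C z w <->
  forall e : R, 0 < e -> exists2 r, 0 < r &
    forall c, C c -> enorm (c - z) < r -> dot w (c - z) <= e * enorm (c - z).
Proof.
split=> wz e /wz.
  by move=> /nbhs_enormP[r r0 h]; exists r => // c Cc /h; exact.
by move=> [r r0 h]; apply/nbhs_enormP; exists r => // c cr Cc; exact: h.
Qed.

(** Expanding the square of [z - c = (z - s) + (s - c)] gives twice [dot (z - s) (c - s)] at most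
    [enorm (c - s) ^+ 2], which is of second order. Only local minimality of [s] enters. *)
Lemma projection_regular_normal n (C : set 'rV[R]_n) (z s : 'rV[R]_n) (r : R) :
  0 < r ->
  (forall c, C c -> enorm (c - s) < r -> enorm (z - s) <= enorm (z - c)) ->
  regular_normal_cone C s (z - s).
Proof.
move=> r0 zs; apply/regular_normal_coneP => e e0.
exists (Num.min r (2 * e)); first by rewrite lt_min r0; lra.
move=> c Cc; rewrite lt_min => /andP[/(zs _ Cc) zsc ce].
have : enorm (z - s) ^+ 2 <= enorm (z - c) ^+ 2.
  by rewrite ler_pXn2r ?nnegrE ?enorm_ge0.
have -> : z - c = (z - s) + (s - c) by rewrite addrA subrK.
rewrite [in leRHS]sqr_enorm dot_sqrD -!sqr_enorm (enormB s c) => h.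
have -> : c - s = - (s - c) by rewrite opprB.
rewrite dotNr enormN (enormB s c).
have : enorm (c - s) ^+ 2 <= 2 * e * enorm (c - s).
  by rewrite expr2 ler_wpM2r ?enorm_ge0 ?ltW.
lra.
Qed.

Lemma regular_normal_coneZ n (C : set 'rV[R]_n) (z w : 'rV[R]_n) (a : R) :
  0 < a -> regular_normal_cone C z w -> regular_normal_cone C z (a *: w).
Proof.
move=> a0 /regular_normal_coneP wz; apply/regular_normal_coneP => e e0.
have [|r r0 h] := wz (e / a); first by rewrite divr_gt0.
exists r => // c Cc /(h _ Cc) {}h.
by rewrite dotZl mulrC -ler_pdivlMr// mulrAC.
Qed.

(** One nearby normal per tolerance suffices: the tolerances [i.+1%:R^-1] recover the two
    sequences. *)
Lemma limiting_normal_coneP n (C : set 'rV[R]_n) (zbar w : 'rV[R]_n) :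
  limiting_normal_cone C zbar w <->
  forall e : R, 0 < e -> exists z w', [/\ C z, enorm (z - zbar) < e,
     regular_normal_cone C z w' & enorm (w' - w) < e].
Proof.
split.
  move=> [z_ [w_ [/cvg_enormP zz Cz Nw /cvg_enormP ww]]] e e0.
  have [i [zi wi]] : exists i, enorm (z_ i - zbar) < e /\ enorm (w_ i - w) < e.
    have [i _ h] := filterI (zz e e0) (ww e e0).
    by exists i; apply: h => /=.
  by exists (z_ i), (w_ i).
move=> wz.
have /choice[z_ /choice[w_ zw]] : forall i : nat, exists z w',
    [/\ C z, enorm (z - zbar) < i.+1%:R^-1,
     regular_normal_cone C z w' & enorm (w' - w) < i.+1%:R^-1].
  by move=> i; apply: wz; rewrite invr_gt0.
exists z_, w_; split.
- apply/cvg_enormP => e e0; have := near_infty_natSinv_lt (PosNum e0).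
  by apply: filterS => i; apply: lt_trans; have [] := zw i.
- by move=> i; have [] := zw i.
- by move=> i; have [] := zw i.
- apply/cvg_enormP => e e0; have := near_infty_natSinv_lt (PosNum e0).
  by apply: filterS => i; apply: lt_trans; have [] := zw i.
Qed.

End variational.

(** * The coderivative criterion *)

Section coderivative_criterion.
Context {R : realType}.
Set Implicit Arguments.
Unset Strict Implicit.
Variables (n m : nat) (S H : setmap R n m).
Variables (xbar : 'rV[R]_n) (ybar : 'rV[R]_m).
Hypothesis Hprefan : prefan H.

Lemma prefan_compact p : compact (H p).
Proof. by have [_ /(_ p)[]] := Hprefan. Qed.

(** Homogeneity reduces [p] to a unit vector, where the finite outer norm is the bound. *)
Lemma prefan_bounded :
  exists2 M : R, 0 <= M &
    forall (p : 'rV[R]_n) z, p != 0 -> H p z -> enorm z <= M * enorm p.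
Proof.
have [[_ homH] _ finH] := Hprefan.
exists `|fine (outer_norm H)| => // p z p0.
have a0 : 0 < enorm p by rewrite enorm_gt0.
have [q q1 ->] : exists2 q, enorm q = 1 & p = enorm p *: q.
  exists ((enorm p)^-1 *: p); last by rewrite scalerA mulfV ?gt_eqF// scale1r.
  by rewrite enormZ gtr0_norm ?invr_gt0// mulVf// gt_eqF.
rewrite homH// => -[z' Hz' <-].
rewrite !enormZ q1 mulr1 (gtr0_norm a0) mulrC ler_pM2r//.
apply: le_trans (ler_norm _).
rewrite -lee_fin fineK//.
apply: (@le_trans _ _ (ereal_sup [set (enorm z)%:E | z in H q])).
  by apply: ereal_sup_ubound; exists z'.
by apply: ereal_sup_ubound; exists q => //=; rewrite q1.
Qed.

(** The ball element is [k - h] divided by the radius. For radius 0 the inverse is 0 and [k = h]. *)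
Lemma fattenE (d : R) (p : 'rV[R]_n) (k : 'rV[R]_m) : 0 <= d ->
  fatten H d p k <-> exists2 h, H p h & enorm (k - h) <= d * enorm p.
Proof.
move=> d0; have c0 : 0 <= d * enorm p by rewrite mulr_ge0 ?enorm_ge0.
split=> [[h Hh [b]]|[h Hh kh]].
  rewrite /eball /= subr0 => b1 <-; exists h => //.
  by rewrite addrAC subrr add0r enormZ ger0_norm// ler_piMr.
exists h => //; exists ((d * enorm p)^-1 *: (k - h)).
  rewrite /eball /= subr0 enormZ ger0_norm ?invr_ge0//.
  have [->|c1] := eqVneq (d * enorm p) 0; first by rewrite invr0 mul0r.
  by rewrite mulrC ler_pdivrMr ?mul1r// lt_def c1.
rewrite scalerA; have [c1|c1] := eqVneq (d * enorm p) 0.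
  rewrite c1 mul0r scale0r addr0; apply/esym/eqP; rewrite -subr_eq0 -enorm_eq0.
  by rewrite eq_le enorm_ge0 andbT -c1.
by rewrite mulfV// scale1r addrC subrK.
Qed.

(* Condition (a) at the regular normals near the reference point, up to an
   error that is uniform in the direction [p]. *)
Definition regular_normal_condition : Prop :=
  forall d : R, 0 < d -> exists2 r : R, 0 < r &
    forall z (v : 'rV[R]_n) (u : 'rV[R]_m),
      gph S z -> enorm (z - row_mx xbar ybar) < r ->
      regular_normal_cone (gph S) z (row_mx v (- u)) ->
      forall p : 'rV[R]_n, p != 0 ->
      exists2 h, H p h & dot u h <= dot v p + d * enorm p * enorm u.

Lemma psd_regular_normal_condition :
  pseudo_strictly_differentiable S H xbar ybar -> regular_normal_condition.
Proof.
have [[_ homH] _ _] := Hprefan; have [M M0 HM] := prefan_bounded.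
move=> psd d d0.
have [U [V [/nbhs_enormP[eU eU0 eUP] /nbhs_enormP[eV eV0 eVP] SUV]]] :=
  psd d d0.
exists (Num.min eU eV); first by rewrite lt_min eU0.
move=> z v u [x [y [Sxy ->]]]; rewrite opp_row_mx add_row_mx => zr.
move=> /regular_normal_coneP Nz p p0.
have xU : enorm (x - xbar) < eU.
  apply: le_lt_trans (enorm_row_mxl _ _) (lt_le_trans zr _).
  by rewrite ge_min lexx.
have yV : enorm (y - ybar) < eV.
  apply: le_lt_trans (enorm_row_mxr _ _) (lt_le_trans zr _).
  by rewrite ge_min lexx orbT.
apply: (compact_le (@prefan_compact p) (@continuous_dot R m u)) => e e0.
have a0 : 0 < enorm p by rewrite enorm_gt0.
(* Moving by [- (t *: p)] displaces the point of the graph by at most [t * K]: the terms bound the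
   base, the element of [H p] and the fattening. *)
pose K := (1 + M + d) * enorm p.
have K0 : 0 < K by rewrite mulr_gt0//; lra.
have [|r' r'0 Nz'] := Nz (e / K); first by rewrite divr_gt0.
(* The first bound keeps the displaced point where the normal inequality holds, the second keeps
   [x - t *: p] in [U]; the factors 2 make both strict. *)
pose t := Num.min (r' / (2 * K)) ((eU - enorm (x - xbar)) / (2 * enorm p)).
have t0 : 0 < t.
  rewrite lt_min; apply/andP; split; apply: divr_gt0 => //; lra.
have tK : t * K < r'.
  suff : t * (2 * K) <= r' by have := mulr_gt0 t0 K0; lra.
  have K2 : 0 < 2 * K by lra.
  by rewrite -(ler_pdivlMr _ _ K2) /t ge_min lexx.
have ta : t * enorm p < eU - enorm (x - xbar).
  suff : t * (2 * enorm p) <= eU - enorm (x - xbar).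
    by have := mulr_gt0 t0 a0; lra.
  have a2 : 0 < 2 * enorm p by lra.
  by rewrite -(ler_pdivlMr _ _ a2) /t ge_min lexx orbT.
have Ux' : U (x - t *: p).
  apply: eUP; rewrite addrAC; apply: le_lt_trans (enormD _ _) _.
  by rewrite enormN enormZ gtr0_norm//; lra.
have [|y' Sy' [k]] := SUV x (x - t *: p) (eUP _ xU) Ux' y.
  by split=> //; exact: eVP.
rewrite opprB addrC subrK => /(fattenE _ _ (ltW d0))[h'].
rewrite homH// => -[h Hh <-]; rewrite enormZ gtr0_norm// => kh ykE.
exists h => //.
have zE : row_mx (x - t *: p) y' - row_mx x y = row_mx (- (t *: p)) (- k).
  rewrite -ykE opp_row_mx add_row_mx addrAC subrr add0r.
  by rewrite opprD addrA subrr add0r.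
have kle : enorm k <= t * enorm h + d * (t * enorm p).
  have := enormD (k - t *: h) (t *: h).
  by rewrite subrK enormZ gtr0_norm//; lra.
have tHM : t * enorm h <= t * (M * enorm p) by rewrite ler_pM2l// HM.
have zK : enorm (row_mx (x - t *: p) y' - row_mx x y) <= t * K.
  rewrite zE; apply: le_trans (enorm_row_mx _ _) _.
  by rewrite !enormN enormZ gtr0_norm// /K; lra.
have Gx' : gph S (row_mx (x - t *: p) y') by exists (x - t *: p), y'.
have := Nz' _ Gx' (le_lt_trans zK tK).
rewrite {1}zE dot_row_mx !dotNr dotNl opprK dotZr => Nzx.
have eK : e / K * enorm (row_mx (x - t *: p) y' - row_mx x y) <= t * e.
  by rewrite mulrAC ler_pdivrMr// (mulrC t) -[leRHS]mulrA ler_pM2l.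
have uk := dot_le u (t *: h - k).
rewrite dotDr dotNr dotZr enormB in uk.
have uk' : enorm u * enorm (k - t *: h) <= enorm u * (d * (t * enorm p)).
  by rewrite ler_wpM2l ?enorm_ge0.
(* The normal inequality reads [- (t * dot v p) + dot u k <= t * e]. Replacing [k] by [t *: h] costs
   at most [d * t * enorm p * enorm u], and [t] cancels. *)
rewrite -(ler_pM2l t0); lra.
Qed.

Lemma regular_normal_condition_limiting :
  regular_normal_condition ->
  forall p : 'rV[R]_n, p != 0 -> forall (v : 'rV[R]_n) (u : 'rV[R]_m),
    limiting_normal_cone (gph S) (row_mx xbar ybar) (row_mx v (- u)) ->
    exists2 y, H p y & dot u y <= dot v p.
Proof.
have [M M0 HM] := prefan_bounded.
move=> cond p p0 v u /limiting_normal_coneP Nvu.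
apply: (compact_le (@prefan_compact p) (@continuous_dot R m u)) => e e0.
have a0 : 0 < enorm p by rewrite enorm_gt0.
have u0 := enorm_ge0 u.
have c1 : 0 < 2 * enorm p * (enorm u + 1) by rewrite !mulr_gt0//; lra.
have c2 : 0 < 2 * enorm p * (1 + M) by rewrite !mulr_gt0//; lra.
(* Half of [e] pays for the error of the condition, where [enorm u' <= enorm u + 1]. The other half,
   through [s], pays for replacing [(v', u')] by [(v, u)]. *)
have [|r r0 {}cond] := cond (e / (2 * enorm p * (enorm u + 1))).
  by rewrite divr_gt0.
set d := e / _ in cond.
have dE : d * enorm p * (enorm u + 1) = e / 2.
  by rewrite /d; field; rewrite !gt_eqF//; lra.
have d0 : 0 < d by rewrite divr_gt0.
pose s := Num.min r (Num.min 1 (e / (2 * enorm p * (1 + M)))).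
have s0 : 0 < s by rewrite !lt_min r0 ltr01 divr_gt0.
have [z [w' [Gz zs Nw ws]]] := Nvu s s0.
have sr : s <= r by rewrite ge_min lexx.
have s1 : s <= 1 by rewrite !ge_min lexx orbT.
have sM : s * (enorm p * (1 + M)) <= e / 2.
  suff : s * (2 * enorm p * (1 + M)) <= e by lra.
  by rewrite -ler_pdivlMr// /s !ge_min lexx !orbT.
have [v' [u' w'E]] := row_mx_split w'.
move: ws; rewrite w'E opp_row_mx add_row_mx opprK => ws.
have vs : enorm (v' - v) < s by apply: le_lt_trans (enorm_row_mxl _ _) ws.
have us : enorm (u - u') < s.
  by rewrite addrC; apply: le_lt_trans (enorm_row_mxr _ _) ws.
rewrite w'E in Nw.
have [h Hh uh] := cond z v' u' Gz (lt_le_trans zs sr) Nw p p0.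
exists h => //.
have h1 := dot_le (u - u') h; rewrite dotDl dotNl in h1.
have h2 := dot_le (v' - v) p; rewrite dotDl dotNl in h2.
have h3 : enorm (u - u') * enorm h <= s * (M * enorm p).
  by apply: ler_pM; rewrite ?enorm_ge0 ?HM// ltW.
have h4 : enorm (v' - v) * enorm p <= s * enorm p by rewrite ler_pM2r// ltW.
have h5 : enorm u' <= enorm u + 1.
  have := enorm_dist u u' 0; rewrite !subr0 enormB; lra.
have h6 : d * enorm p * enorm u' <= d * enorm p * (enorm u + 1).
  by rewrite ler_pM2l// mulr_gt0.
lra.
Qed.

Lemma limiting_regular_normal_condition :
  (forall p : 'rV[R]_n, p != 0 -> forall (v : 'rV[R]_n) (u : 'rV[R]_m),
    limiting_normal_cone (gph S) (row_mx xbar ybar) (row_mx v (- u)) ->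
    exists2 y, H p y & dot u y <= dot v p) ->
  regular_normal_condition.
Proof.
have [M M0 HM] := prefan_bounded.
move=> lim d d0; apply: contrapT => nH.
have bad r : 0 < r -> exists z v u, [/\ gph S z,
    enorm (z - row_mx xbar ybar) < r,
    regular_normal_cone (gph S) z (row_mx v (- u)),
    enorm (row_mx v (- u)) = 1 &
    exists2 p, p != 0 & forall h, H p h ->
      dot v p + d * enorm p * enorm u < dot u h].
  move=> r0; apply: contrapT => nb; apply: nH; exists r => //.
  move=> z v u Gz zr Nvu p p0; apply: contrapT => nh; apply: nb.
  have hp h : H p h -> dot v p + d * enorm p * enorm u < dot u h.
    by move=> Hh; rewrite ltNge; apply/negP => uh; apply: nh; exists h.
  (* A zero normal would make the strict failure at [h] read [0 < 0], so the normal can be scaled to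
     unit length. *)
  have a0 : 0 < enorm (row_mx v (- u)).
    rewrite enorm_gt0; apply/eqP; rewrite -[0]row_mx0 => /eq_row_mx[v0 u0].
    have [_ /(_ p)[[h Hh] _ _] _] := Hprefan.
    have := hp h Hh; rewrite v0 -[u]opprK u0 oppr0 !dot0l enorm0 mulr0 addr0.
    by rewrite ltxx.
  set a := enorm _ in a0.
  exists z, (a^-1 *: v), (a^-1 *: u); rewrite -scalerN -scale_row_mx.
  split=> //.
  - by apply: regular_normal_coneZ => //; rewrite invr_gt0.
  - by rewrite enormZ gtr0_norm ?invr_gt0// mulVf// gt_eqF.
  - exists p => // h /hp.
    rewrite !dotZl enormZ gtr0_norm ?invr_gt0// mulrCA -mulrDr.
    by rewrite ltr_pM2l ?invr_gt0.
have /choice[z_ /choice[v_ /choice[u_ zvu]]] (i : nat) :=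
  bad i.+1%:R^-1 (etrans (invr_gt0 _) (ltr0Sn _ _)).
have w1 i : enorm (row_mx (v_ i) (- u_ i)) <= 1 by have [_ _ _ ->] := zvu i.
have [l wl] := bounded_seq_cluster w1.
have lN : limiting_normal_cone (gph S) (row_mx xbar ybar) l.
  apply/limiting_normal_coneP => e e0.
  have [N _ Ne] := near_infty_natSinv_lt (PosNum e0).
  have [i Ni il] := wl e e0 N; have [Gz zr Nz _ _] := zvu i.
  exists (z_ i), (row_mx (v_ i) (- u_ i)); split=> //.
  exact: lt_trans zr (Ne i Ni).
have l0 : l != 0.
  apply/eqP => l0; have [i _] := wl 1 ltr01 0%N.
  by rewrite l0 subr0; have [_ _ _ -> _] := zvu i; rewrite ltxx.
have [v [u lE]] := row_mx_split l.
rewrite lE in wl lN l0.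
(* If [u = 0] then [v] is nonzero, and (a) in the direction [- v] gives [0 <= - enorm v ^+ 2]. *)
have u0 : 0 < enorm u.
  rewrite enorm_gt0; apply: contra_neq l0 => u0.
  rewrite u0 oppr0; have [->|v0] := eqVneq v 0; first exact: row_mx0.
  have [|y _] := lim (- v) _ v u lN; first by rewrite oppr_eq0.
  rewrite u0 dot0l dotNr -sqr_enorm oppr_ge0 => h.
  have : 0 < enorm v ^+ 2 by rewrite exprn_gt0// enorm_gt0.
  by rewrite ltNge h.
have K0 : 0 < 1 + M + d by lra.
(* With this [e], the approximation error [e * (1 + M) * enorm p] equals the lower bound
   [d * enorm p * (enorm u - e)] of the margin, contradicting the strict failure. Every term is
   proportional to [enorm p], so [p] may depend on [i]. *)
have e0 : 0 < d * enorm u / (1 + M + d) by rewrite divr_gt0// mulr_gt0.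
set e := _ / _ in e0.
have eE : e * (1 + M + d) = d * enorm u by rewrite /e mulfVK// gt_eqF.
have [i _] := wl e e0 0%N; have [_ _ _ _ [p p0 hp]] := zvu i.
rewrite opp_row_mx add_row_mx opprK => wle.
have vle : enorm (v - v_ i) < e.
  by rewrite enormB; apply: le_lt_trans (enorm_row_mxl _ _) wle.
have ule : enorm (u - u_ i) < e.
  by rewrite addrC; apply: le_lt_trans (enorm_row_mxr _ _) wle.
have [h Hh uh] := lim p p0 v u lN.
have a0 : 0 < enorm p by rewrite enorm_gt0.
have := hp h Hh.
have h1 := dot_le (u_ i - u) h; rewrite dotDl dotNl enormB in h1.
have h2 := dot_le (v - v_ i) p; rewrite dotDl dotNl in h2.
have h3 : enorm (u - u_ i) * enorm h <= e * (M * enorm p).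
  by apply: ler_pM; rewrite ?enorm_ge0 ?HM// ltW.
have h4 : enorm (v - v_ i) * enorm p <= e * enorm p by rewrite ler_pM2r// ltW.
have h5 : enorm u - e <= enorm (u_ i).
  have := enorm_dist (u_ i) u 0; rewrite !subr0; lra.
have h6 : d * enorm p * (enorm u - e) <= d * enorm p * enorm (u_ i).
  by rewrite ler_pM2l// mulr_gt0.
have h7 : d * enorm p * (enorm u - e) = enorm p * (e * (1 + M)).
  by rewrite -mulrA mulrCA mulrBr -eE; ring.
lra.
Qed.


Lemma regular_normal_condition_psd :
  locally_closed_at S xbar ybar -> regular_normal_condition ->
  pseudo_strictly_differentiable S H xbar ybar.
Proof.
have [[H00 _] Hcc _] := Hprefan; have [M M0 HM] := prefan_bounded.
move=> [e e0 clC] cond d d0; have [r0 r00 {}cond] := cond d d0.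
pose K := 1 + M + d.
have K1 : 1 <= K by rewrite /K; lra.
(* Each nearest point [s] below lies within [2 * eta + 2 * (K * eta) + 2 * (K * eta)] of [zbar],
   which is at most [6 * (K * eta)] and so less than [r]. *)
pose r := Num.min r0 e; pose eta := r / (8 * K).
have rr : 0 < r by rewrite lt_min r00.
have eta0 : 0 < eta by rewrite divr_gt0//; lra.
have etaK : 8 * (K * eta) = r by rewrite /eta; field; rewrite gt_eqF//; lra.
have etaK1 : eta <= K * eta by rewrite ler_peMl// ltW.
have rle0 : r <= r0 by rewrite /r ge_min lexx.
have rle : r <= e by rewrite /r ge_min lexx orbT.
exists [set x | enorm (x - xbar) < eta], [set y | enorm (y - ybar) < eta].
split; [by apply/nbhs_enormP; exists eta|by apply/nbhs_enormP; exists eta|].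
move=> x x' /= xU x'U y [Sx /= yV].
(* The condition speaks of nonzero directions only; for [x = x'] the point [y] itself serves, as [0]
   lies in [H 0]. *)
have [<-|p0] := eqVneq x x'.
  exists y => //; exists 0; last by rewrite addr0.
  by apply/(fattenE _ _ (ltW d0)); exists 0; rewrite !subrr ?enorm0 ?mulr0.
rewrite -subr_eq0 in p0; set p := x - x' in p0 *.
have a0 : 0 < enorm p by rewrite enorm_gt0.
have ple : enorm p <= 2 * eta.
  by have := enorm_dist xbar x x'; rewrite (enormB xbar); rewrite -/p; lra.
pose zbar := row_mx xbar ybar; pose z0 := row_mx x y.
pose C := gph S `&` eball zbar e.
have cC : compact C.
  by apply: (bounded_enorm_compact (x := zbar) (M := e) clC) => a [].
have z0bar : enorm (z0 - zbar) <= 2 * eta.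
  rewrite opp_row_mx add_row_mx; apply: le_trans (enorm_row_mx _ _) _; lra.
have Cz0 : C z0.
  by split; [exists x, y|rewrite /eball /=; apply: le_trans z0bar _; lra].
pose F := [set row_mx (- p) (- k) | k in fatten H d p].
have [[h0 Hh0] /convex_setE cvxH cH] := Hcc p.
have F0 : F !=set0.
  exists (row_mx (- p) (- h0)); exists h0 => //.
  apply/(fattenE _ _ (ltW d0)); exists h0 => //.
  by rewrite subrr enorm0 mulr_ge0 ?enorm_ge0// ltW.
have clF : closed F.
  move=> f /closure_enormP fF; have [f1 [f2 fE]] := row_mx_split f.
  exists f2.
    apply/(fattenE _ _ (ltW d0)).
    suff [h Hh hf] : exists2 h, H p h & enorm (h - f2) <= d * enorm p.
      by exists h => //; rewrite enormB.
    apply: (compact_le cH (@continuous_enorm_sub R m f2)) => e'.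
    move=> /fF[a [k Fk <-]]; move: Fk => /(fattenE _ _ (ltW d0))[h Hh kh].
    rewrite fE opp_row_mx add_row_mx opprK => ale; exists h => //.
    have kf : enorm (f2 - k) < e'.
      by rewrite addrC; apply: le_lt_trans (enorm_row_mxr _ _) ale.
    have := enorm_dist k h f2; rewrite (enormB h k) (enormB k f2); lra.
  rewrite fE; congr row_mx; apply/eqP; rewrite -subr_eq0 -enorm_eq0.
  rewrite eq_le enorm_ge0 andbT; apply/ler_addgt0Pr => e' /fF[a [k Fk <-]].
  rewrite fE opp_row_mx add_row_mx add0r => /ltW.
  by apply: le_trans; exact: enorm_row_mxl.
have cvxF : convex_set F.
  apply/convex_setE => f g t [k Fk <-] [k' Fk' <-] t0 t1.
  exists (t *: k + (1 - t) *: k').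
    move: Fk Fk' => /(fattenE _ _ (ltW d0))[h Hh kh].
    move=> /(fattenE _ _ (ltW d0))[h' Hh' kh'].
    apply/(fattenE _ _ (ltW d0)); exists (t *: h + (1 - t) *: h').
      exact: cvxH.
    rewrite opprD addrACA -!scalerBr; apply: le_trans (enormD _ _) _.
    rewrite !enormZ !ger0_norm// ?subr_ge0//.
    have -> : d * enorm p = t * (d * enorm p) + (1 - t) * (d * enorm p) by ring.
    by rewrite lerD// ler_wpM2l// subr_ge0.
  rewrite !scale_row_mx add_row_mx !scalerN -!opprD -scalerDl; congr row_mx.
  by rewrite addrC subrK scale1r.
have FL f : F f -> enorm f <= K * enorm p.
  move=> [k /(fattenE _ _ (ltW d0))[h Hh kh] <-].
  apply: le_trans (enorm_row_mx _ _) _; rewrite !enormN.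
  have := enormD (k - h) h; rewrite subrK.
  by have := HM p h p0 Hh; rewrite /K; lra.
have KL : K * enorm p <= 2 * (K * eta).
  by rewrite mulrCA ler_wpM2l//; lra.
(* Since [x - p = x'], the endpoint [z0 + f] in [C] is the pair [(x', y - k)] of the graph. The
   aiming hypothesis is checked first. *)
have [|f [k Fk <-] [[x1 [y1 [Sx1]]]]] := weak_invariance cC Cz0 F0 clF cvxF FL.
  move=> z s zz0 [Gs sbar] zs.
  have zsz0 : enorm (z - s) <= enorm (z - z0) by exact: zs.
  have {}sbar : enorm (s - zbar) < r.
    have := enorm_dist z s zbar; have := enorm_dist z0 z zbar.
    rewrite (enormB s z); lra.
  have Nzs : regular_normal_cone (gph S) s (z - s).
    (* Points of the graph within this radius of [s] stay in the ball defining [C], so [s] is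
       locally nearest in the whole graph. *)
    apply: (@projection_regular_normal _ _ _ _ _ (e - enorm (s - zbar))).
      by rewrite subr_gt0; lra.
    move=> c Gc cs; apply: zs; split=> //; rewrite /eball /=.
    have := enorm_dist s c zbar; lra.
  have [v [u zsE]] := row_mx_split (z - s).
  rewrite zsE in Nzs *.
  have [h Hh uh] := cond s v u Gs (lt_le_trans sbar rle0) Nzs p p0.
  (* Moving [h] against [u] by the full fattening radius lowers [dot u h] by
     [d * enorm p * enorm u], exactly the error of the condition. For [u = 0] the shift vanishes. *)
  pose k := h - (d * enorm p / enorm u) *: u.
  exists (row_mx (- p) (- k)).
    exists k => //; apply/(fattenE _ _ (ltW d0)); exists h => //.
    rewrite /k addrAC subrr add0r enormN enormZ.
    have [->|u0] := eqVneq u 0; first by rewrite enorm0 mulr0 mulr_ge0 ?ltW.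
    have c0 := divr_ge0 (mulr_ge0 (ltW d0) (ltW a0)) (enorm_ge0 u).
    by rewrite (ger0_norm c0) divfK// enorm_eq0.
  rewrite dot_row_mx !dotNr dotNl opprK /k dotDr dotNr dotZr -sqr_enorm.
  have -> : d * enorm p / enorm u * enorm u ^+ 2 = d * enorm p * enorm u.
    have [->|u0] := eqVneq u 0; first by rewrite enorm0 expr0n /= !mulr0.
    by rewrite expr2 mulrA divfK// enorm_eq0.
  lra.
rewrite add_row_mx => /eq_row_mx[x1E y1E] _.
exists (y - k); last by exists k => //; rewrite subrK.
by move: Sx1; rewrite -x1E -y1E /p opprB addrC subrK.
Qed.

End coderivative_criterion.

(** * Infima of linear forms and closed convex hulls *)

Lemma ereal_inf_dot_le (R : realType) (n : nat) (A : set 'rV[R]_n)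
    (u : 'rV[R]_n) (c : R) :
  A !=set0 -> compact A ->
  (ereal_inf [set (dot u y)%:E | y in A] <= c%:E)%E <->
  exists2 y, A y & dot u y <= c.
Proof.
move=> A0 cA; split=> [Ac|[y Ay uy]]; last first.
  by apply: ge_ereal_inf; exists (dot u y)%:E; [exists y|rewrite lee_fin].
have [y Ay ymin] := compact_min A0 cA (@continuous_dot R n u).
exists y => //; rewrite -lee_fin; apply: le_trans Ac.
by apply/ereal_infP => _ [b Ab <-]; rewrite lee_fin ymin.
Qed.

Lemma closed_convex_hull_sub (R : realType) (n : nat) (A B : set 'rV[R]_n) :
  closed B -> convex_set B -> A `<=` B -> closed_convex_hull A `<=` B.
Proof.
move=> clB cvxB AB; rewrite /closed_convex_hull closureE.
by apply: smallest_sub => //; exact: smallest_sub.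
Qed.

Lemma sub_closed_convex_hull (R : realType) (n : nat) (A : set 'rV[R]_n) :
  A `<=` closed_convex_hull A.
Proof.
by apply: subset_trans (@subset_closure _ _); exact: sub_gen_smallest.
Qed.

(** The vectors [v] with [dot v p] at least the infimum over [A] form a closed convex set containing
    [A], hence its hull. *)
Lemma ereal_inf_closed_convex_hull (R : realType) (n : nat) (A : set 'rV[R]_n)
    (p : 'rV[R]_n) :
  ereal_inf [set (dot v p)%:E | v in closed_convex_hull A] =
  ereal_inf [set (dot v p)%:E | v in A].
Proof.
apply/eqP; rewrite eq_le; apply/andP; split.
  apply: ereal_inf_le_tmp; apply: image_subset; exact: sub_closed_convex_hull.
apply/ereal_infP => _ [v Av <-]; move: v Av.
set c := ereal_inf _.
apply: (@closed_convex_hull_sub R n A [set v | (c <= (dot v p)%:E)%E]).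
- move=> v /closure_enormP vc /=; apply/lee_addgt0Pr => e e0.
  have a0 : 0 < enorm p + 1 by have := enorm_ge0 p; lra.
  have [|a /= ca va] := vc (e / (enorm p + 1)); first by rewrite divr_gt0.
  apply: le_trans ca _; rewrite -EFinD lee_fin.
  have := dot_le (a - v) p; rewrite dotDl dotNl.
  move: va; rewrite ltr_pdivlMr// => va.
  by have := enorm_ge0 (a - v); lra.
- apply/convex_setE => a b t; rewrite /= => ca cb t0 t1.
  (* The convex combination is bounded below by the smaller of the two real values, which avoids
     arithmetic with a possibly infinite [c]. *)
  have [ab|/ltW ab] := leP (dot a p) (dot b p).
    apply: le_trans ca _; rewrite lee_fin dotDl !dotZl.
    have : 0 <= (1 - t) * (dot b p - dot a p) by rewrite mulr_ge0 ?subr_ge0.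
    lra.
  apply: le_trans cb _; rewrite lee_fin dotDl !dotZl.
  have : 0 <= t * (dot a p - dot b p) by rewrite mulr_ge0 ?subr_ge0.
  lra.
- by move=> a Aa; apply: ereal_inf_lbound; exists a.
Qed.

Theorem theorem5p4 (R : realType) (n m : nat) (S H : setmap R n m)
    (xbar : 'rV[R]_n) (ybar : 'rV[R]_m)
    (Sxy : S xbar ybar)
    (Sclosed : locally_closed_at S xbar ybar)
    (Hprefan : prefan H) :
  [/\ pseudo_strictly_differentiable S H xbar ybar <->
        (forall p : 'rV[R]_n, p <> 0 ->
         forall (v : 'rV[R]_n) (u : 'rV[R]_m),
           limiting_normal_cone (gph S) (row_mx xbar ybar) (row_mx v (- u)) ->
           exists2 y, H p y & dot u y <= dot v p),
      pseudo_strictly_differentiable S H xbar ybar <->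
        (forall p : 'rV[R]_n, p <> 0 -> forall u : 'rV[R]_m,
           (ereal_inf [set (dot u y)%:E | y in H p] <=
            ereal_inf [set (dot v p)%:E
                      | v in limiting_coderivative S xbar ybar u])%E) &
      pseudo_strictly_differentiable S H xbar ybar <->
        (forall p : 'rV[R]_n, p <> 0 -> forall u : 'rV[R]_m,
           (ereal_inf [set (dot u y)%:E | y in H p] <=
            ereal_inf [set (dot v p)%:E
                      | v in closed_convex_hull
                               (limiting_coderivative S xbar ybar u)])%E)].
Proof.
have psdP : pseudo_strictly_differentiable S H xbar ybar <->
    (forall p : 'rV[R]_n, p <> 0 -> forall (v : 'rV[R]_n) (u : 'rV[R]_m),
       limiting_normal_cone (gph S) (row_mx xbar ybar) (row_mx v (- u)) ->
       exists2 y, H p y & dot u y <= dot v p).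
  split=> [psd p /eqP p0|lim].
    apply: (regular_normal_condition_limiting Hprefan) => //.
    exact: psd_regular_normal_condition.
  apply: regular_normal_condition_psd => //.
  by apply: limiting_regular_normal_condition => // p /eqP; exact: lim.
have infP : pseudo_strictly_differentiable S H xbar ybar <->
    (forall p : 'rV[R]_n, p <> 0 -> forall u : 'rV[R]_m,
       (ereal_inf [set (dot u y)%:E | y in H p] <=
        ereal_inf [set (dot v p)%:E
                  | v in limiting_coderivative S xbar ybar u])%E).
  have [_ Hp _] := Hprefan.
  (* Condition (b) is (a) collected over all [v] for fixed [u]; compactness of [H p] makes the left
     infimum attained. *)
  rewrite psdP; split=> [lim p p0 u|lim p p0 v u Nvu].
    have [Hp0 _ cHp] := Hp p.
    apply/ereal_infP => _ [v Nvu <-].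
    by apply/ereal_inf_dot_le => //; exact: lim.
  have [Hp0 _ cHp] := Hp p.
  apply/ereal_inf_dot_le => //; apply: le_trans (lim p p0 u) _.
  by apply: ereal_inf_lbound; exists v.
split=> //; rewrite infP; split=> h p p0 u; have := h p p0 u;
  by rewrite ereal_inf_closed_convex_hull.
Qed.
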